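(* Let $n\ge 1$ and let $U\in U(2^n)$ be a generalized semi-Clifford gate. Then $U\in\mathcal{CH}$ if and only if $U$ can be written (up to a global phase) in the form $$U = C_1\, P\, D\, C_2,$$ where $C_1,C_2$ are $n$-qubit Clifford gates, $P$ is a $2^n\times 2^n$ permutation matrix with $P\in\mathcal{CH}$, and $D=\prod_j\exp\left(i\frac{\alpha_j\pi}{2^{k_j}}Z_j\right)$ is a diagonal gate in $\mathcal{CH}$, with $Z_j$ Pauli $Z$ strings, $\alpha_j$ integers and $k_j$ positive integers.
   Context: Gates are unitary matrices in $U(2^n)$ considered up to a global phase. A Pauli string is an element of the $n$-qubit Pauli group $\mathcal{P}_n=\langle i,X,Z\rangle^{\otimes n}$; a Pauli $Z$ string is a tensor product of $Z$'s and identities. The Clifford Hierarchy is defined by $\mathcal{CH}_1=\mathcal{P}_n$ (up to phase) and, for $k\ge 2$, $\mathcal{CH}_k=\{U\in U(2^n) : UpU^\dagger\in\mathcal{CH}_{k-1}\ \forall p\in\mathcal{P}_n\}$; $\mathcal{CH}_2$ is the $n$-qubit Clifford group. A gate is in $\mathcal{CH}$ if it is in $\mathcal{CH}_k$ for some $k\ge 1$. A gate $U\in U(2^n)$ is generalized semi-Clifford if it can be written (up to phase) as $C_1P\prod_j\exp(i\theta_jZ_j)C_2$ with $C_1,C_2$ $n$-qubit Clifford gates, $P$ a $2^n\times2^n$ permutation matrix, $\theta_j\in[0,2\pi)$ and $Z_j$ Pauli $Z$ strings. *)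

(* Defs.v *)
From HB Require Import structures.
From mathcomp Require Import all_boot all_order all_algebra.
From mathcomp Require Import spectral complex mxtens.
From mathcomp Require Import all_classical all_reals all_analysis.

Set Implicit Arguments.
Unset Strict Implicit.
Unset Printing Implicit Defensive.

Import Order.TTheory GRing.Theory Num.Theory.
Import numFieldNormedType.Exports.

Local Open Scope sesquilinear_scope.
Local Open Scope classical_set_scope.
Local Open Scope ring_scope.
Local Open Scope complex_scope.

(* The matrix exponential, as the limit of its power series.  It is stated for
   an abstract numClosedFieldType because the topology of a numeric field is
   only inferred there, not directly on R[i]. *)
Definition expmx (C : numClosedFieldType) (m : nat) (A : 'M[C]_m) : 'M[C]_m :=
  lim (series (fun k : nat => k`!%:R^-1 *: A ^+ k) @ \oo).

(* The n-fold Kronecker product A_0 *t ... *t A_(n-1); the casts are along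
   2 * 2 ^ n = 2 ^ n.+1, which does not hold by computation. *)
Fixpoint tensn (K : pzRingType) (n : nat) :
    ('I_n -> 'M[K]_2) -> 'M[K]_(2 ^ n) :=
  match n with
  | 0 => fun=> 1%:M
  | n'.+1 => fun A =>
      castmx (esym (expnS 2 n'), esym (expnS 2 n'))
        (A ord0 *t tensn (fun i => A (lift ord0 i)))
  end.

Section Gates.
Variable R : realType.
Implicit Types n k : nat.

Definition pauliX : 'M[R[i]]_2 := \matrix_(i, j) (i != j)%:R.
Definition pauliZ : 'M[R[i]]_2 := diag_mx (\row_j (-1) ^+ j).

(* The subgroup of GL_2 generated by i, X and Z. *)
Inductive pauli1 : 'M[R[i]]_2 -> Prop :=
| Pauli1_one : pauli1 1%:M
| Pauli1_i : pauli1 ('i%:M)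
| Pauli1_X : pauli1 pauliX
| Pauli1_Z : pauli1 pauliZ
| Pauli1_mul p q : pauli1 p -> pauli1 q -> pauli1 (p *m q)
| Pauli1_inv p : pauli1 p -> pauli1 (invmx p).

Definition pauli n (p : 'M[R[i]]_(2 ^ n)) : Prop :=
  exists2 s : 'I_n -> 'M[R[i]]_2, (forall q, pauli1 (s q)) & p = tensn s.

(* The Pauli Z string acting as Z on the qubits of S, trivially elsewhere. *)
Definition zstring n (S : {set 'I_n}) : 'M[R[i]]_(2 ^ n) :=
  tensn (fun q => if q \in S then pauliZ else 1%:M).

Definition eq_phase m (A B : 'M[R[i]]_m) : Prop :=
  exists2 c : R[i], `|c| = 1 & A = c *: B.

(* Levels are numbered from 1, so level 0 is empty. *)
Fixpoint CHlevel n k (U : 'M[R[i]]_(2 ^ n)) : Prop :=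
  match k with
  | 0 => False
  | 1 => exists2 p, pauli p & eq_phase U p
  | k'.+1 => U \is unitarymx /\
      forall p, pauli p -> CHlevel k' (U *m p *m U^t*)
  end.

Definition CH n (U : 'M[R[i]]_(2 ^ n)) : Prop :=
  exists2 k, (1 <= k)%N & CHlevel k U.

Definition clifford n (U : 'M[R[i]]_(2 ^ n)) : Prop := CHlevel 2 U.

Definition zrot n (theta : R) (S : {set 'I_n}) : 'M[R[i]]_(2 ^ n) :=
  expmx (('i * theta%:C) *: zstring S).

Definition gen_semi_clifford n (U : 'M[R[i]]_(2 ^ n)) : Prop :=
  U \is unitarymx /\
  exists (C1 P C2 : 'M[R[i]]_(2 ^ n)) (m : nat)
         (theta : 'I_m -> R) (S : 'I_m -> {set 'I_n}),
  [/\ clifford C1, clifford C2, is_perm_mx P,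
      forall j, 0 <= theta j < 2 * pi &
      eq_phase U (C1 *m P *m (\prod_(j < m) zrot (theta j) (S j)) *m C2)].

End Gates.

(* Main.v *)
(* A diagonal gate D with entries f satisfies
   D X_a Z_b D^* = X_a Z_b D_a with D_a(x) = f(x + a) / f(x).
   If the entries of f are 2^m-th roots of unity, iterating these quotients
   reaches a constant, so D is in the hierarchy.  For a permutation P one has
   (P D) X_a Z_b (P D)^* = (P X_a P^* ) (diagonal), with the permutation
   P X_a P^* one level below P; by induction on the level, P D is in the
   hierarchy when P is and D has dyadic entries, and conversely membership of
   P D forces P into the hierarchy and every D_a to be dyadic up to a phase.
   Since f(x)^2 / f(0)^2 is a quotient of two entries of D_x, D itself is then
   dyadic up to a phase, and the Walsh-Hadamard transform of its phases writes
   it as a product of Z-string rotations by dyadic angles. *)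
Require Import Defs.
From HB Require Import structures.
From mathcomp Require Import all_boot all_order all_algebra.
From mathcomp Require Import fingroup perm spectral complex mxtens.
From mathcomp Require Import all_classical all_reals all_analysis ring.

Set Implicit Arguments.
Unset Strict Implicit.
Unset Printing Implicit Defensive.

Import Order.TTheory GRing.Theory Num.Theory.
Import numFieldNormedType.Exports.

Local Open Scope sesquilinear_scope.
Local Open Scope classical_set_scope.
Local Open Scope ring_scope.
Local Open Scope complex_scope.

(** * Pauli strings as monomial matrices *)

Lemma tensnE (K : pzRingType) n (A : 'I_n.+1 -> 'M[K]_2) i j :
  let u k := mxtens_unindex (cast_ord (expnS 2 n) k) in
  tensn A i j =
  A ord0 (u i).1 (u j).1 * tensn (fun q => A (lift ord0 q)) (u i).2 (u j).2.
Proof. by rewrite /= castmxE mxE !esymK. Qed.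

(** The recursion follows that of [tensn], so that entries of a Kronecker product factor over the
    qubits. *)
Fixpoint bit n : 'I_(2 ^ n) -> 'I_n -> 'I_2 :=
  match n with
  | 0 => fun _ _ => ord0
  | n'.+1 => fun i q =>
      let k := mxtens_unindex (cast_ord (expnS 2 n') i) in
      oapp (bit k.2) k.1 (unlift ord0 q)
  end.

Lemma tensn_prod (K : pzRingType) n (A : 'I_n -> 'M[K]_2) i j :
  tensn A i j = \prod_q A q (bit i q) (bit j q).
Proof.
elim: n => [|n IHn] in A i j *; first by rewrite big_ord0 mxE (ord1 i) (ord1 j).
rewrite tensnE IHn big_ord_recl /= unlift_none; congr (_ * _).
by apply: eq_bigr => q _; rewrite liftK.
Qed.

Lemma bit_inj n (i j : 'I_(2 ^ n)) : bit i =1 bit j -> i = j.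
Proof.
elim: n => [|n IHn] in i j *; first by rewrite (ord1 i) (ord1 j).
move=> eq_ij; apply: (@cast_ord_inj _ _ (expnS 2 n)).
rewrite -[LHS]mxtens_unindexK -[RHS]mxtens_unindexK; congr mxtens_index.
rewrite [LHS]surjective_pairing [RHS]surjective_pairing; congr (_, _).
  by have := eq_ij ord0; rewrite /= unlift_none.
by apply: IHn => q; have := eq_ij (lift ord0 q); rewrite /= liftK.
Qed.

Definition bits n (i : 'I_(2 ^ n)) : {ffun 'I_n -> 'I_2} := [ffun q => bit i q].

Lemma bits_inj n : injective (@bits n).
Proof.
move=> i j /ffunP eq_ij; apply: bit_inj => q.
by have := eq_ij q; rewrite !ffunE.
Qed.

Lemma bits_onto n (v : {ffun 'I_n -> 'I_2}) : v \in codom (@bits n).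
Proof.
by apply: inj_card_onto (@bits_inj n) _ v; rewrite card_ffun !card_ord.
Qed.

Definition unbits n (v : {ffun 'I_n -> 'I_2}) : 'I_(2 ^ n) :=
  iinv (bits_onto v).

Lemma unbitsK n : cancel (@unbits n) (@bits n).
Proof. by move=> v; rewrite f_iinv. Qed.

Lemma I2_addxx (x : 'I_2) : x + x = 0.
Proof. by case: x => [[|[]]] // p; apply: val_inj. Qed.

Lemma bitvec_addxx n (v : {ffun 'I_n -> 'I_2}) : v + v = 0.
Proof. by apply/ffunP => q; rewrite !ffunE I2_addxx. Qed.

Lemma shift_inj n (a : {ffun 'I_n -> 'I_2}) :
  injective (fun j => unbits (bits j + a)).
Proof.
by move=> i j /(can_inj (@unbitsK n)) /addIr; apply: bits_inj.
Qed.

(** Translation by a vector of F_2^n: the action on basis states of the X part of a Pauli string. *)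
Definition shift n (a : {ffun 'I_n -> 'I_2}) : {perm 'I_(2 ^ n)} :=
  perm (@shift_inj n a).

Lemma bits_shift n (a : {ffun 'I_n -> 'I_2}) j : bits (shift a j) = bits j + a.
Proof. by rewrite permE unbitsK. Qed.

Lemma shiftD n (a b : {ffun 'I_n -> 'I_2}) :
  shift (a + b) = (shift a * shift b)%g.
Proof. by apply/permP => j; apply: bits_inj; rewrite permM !bits_shift addrA. Qed.

Lemma shift0 n : shift (0 : {ffun 'I_n -> 'I_2}) = 1%g.
Proof. by apply/permP => j; apply: bits_inj; rewrite perm1 bits_shift addr0. Qed.

Lemma shiftK n (a : {ffun 'I_n -> 'I_2}) : involutive (shift a).
Proof. by move=> j; rewrite -permM -shiftD bitvec_addxx shift0 perm1. Qed.

Lemma shiftV n (a : {ffun 'I_n -> 'I_2}) : ((shift a)^-1)%g = shift a.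
Proof.
by apply/permP => j; apply: (@perm_inj _ (shift a)); rewrite permKV shiftK.
Qed.

Lemma shiftC n (a b : {ffun 'I_n -> 'I_2}) j :
  shift a (shift b j) = shift b (shift a j).
Proof. by rewrite -!permM -!shiftD addrC. Qed.

Lemma shift_bits n (i j : 'I_(2 ^ n)) : shift (bits j - bits i) i = j.
Proof. by apply: bits_inj; rewrite bits_shift addrC subrK. Qed.

(** The character of F_2^n indexed by [b], which is the diagonal of a Z string. Integer values let
    signs be settled before they are cast into a field. *)
Definition chi n (b v : {ffun 'I_n -> 'I_2}) : int :=
  \prod_q (-1) ^+ (b q * v q).

Lemma chiC n (b v : {ffun 'I_n -> 'I_2}) : chi b v = chi v b.
Proof. by apply: eq_bigr => q _; rewrite mulnC. Qed.

Lemma chiDr n (b v w : {ffun 'I_n -> 'I_2}) : chi b (v + w) = chi b v * chi b w.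
Proof.
rewrite /chi -big_split; apply: eq_bigr => q _; rewrite !ffunE /=.
by move: (b q) (v q) (w q) => [[|[]]//?] [[|[]]//?] [[|[]]//?].
Qed.

Lemma chi0r n (b : {ffun 'I_n -> 'I_2}) : chi b 0 = 1.
Proof. by apply: big1 => q _; rewrite ffunE muln0. Qed.

Lemma chi0l n (v : {ffun 'I_n -> 'I_2}) : chi 0 v = 1.
Proof. by rewrite chiC chi0r. Qed.

Lemma chi_sqr n (b v : {ffun 'I_n -> 'I_2}) : chi b v * chi b v = 1.
Proof. by rewrite -chiDr bitvec_addxx chi0r. Qed.

Lemma chi_norm n (b v : {ffun 'I_n -> 'I_2}) : `|chi b v| = 1.
Proof.
by rewrite normr_prod big1 // => q _; rewrite normrX normrN1 expr1n.
Qed.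

Lemma chi_inj n (b c : {ffun 'I_n -> 'I_2}) : chi b =1 chi c -> b = c.
Proof.
move=> eq_bc; apply/ffunP => q.
(* At the unit vector of qubit [q] the character reads off the single bit [d q]. *)
have chiE (d : {ffun 'I_n -> 'I_2}) :
    chi d [ffun r => if r == q then 1 else 0] = (-1) ^+ d q.
  rewrite /chi (bigD1 q) //= big1 ?ffunE ?eqxx ?muln1 ?mulr1 // => r neq_rq.
  by rewrite ffunE (negPf neq_rq) muln0.
have := eq_bc [ffun r => if r == q then 1 else 0]; rewrite !chiE.
by move: (b q) (c q) => [[|[]]//?] [[|[]]//?] // _; apply: val_inj.
Qed.

(** * Monomial matrices *)

Section Monomial.
Variables (C : numClosedFieldType) (N : nat).
Implicit Types (s t : {perm 'I_N}) (f g : 'I_N -> C).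

(** Column convention: the basis vector e_j goes to [f j] times the basis vector at [s j]. Hence
    [perm_mx s] carries the inverse permutation. *)
Definition mon s f : 'M[C]_N := \matrix_(i, j) ((i == s j)%:R * f j).

Lemma mon_ext s f g : f =1 g -> mon s f = mon s g.
Proof. by move=> eq_fg; apply/matrixP => i j; rewrite !mxE eq_fg. Qed.

Lemma mon_mul s t f g :
  mon s f *m mon t g = mon (t * s)%g (fun j => f (t j) * g j).
Proof.
apply/matrixP => i j; rewrite !mxE permM (bigD1 (t j)) //= big1 => [|k neq_k].
  by rewrite !mxE eqxx mul1r addr0 mulrA.
by rewrite !mxE (negPf neq_k) mul0r mulr0.
Qed.

Lemma mon_adj s f :
  (mon s f)^t* = mon (s^-1)%g (fun j => ((f ((s^-1)%g j))^*)%R).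
Proof.
apply/matrixP => i j; rewrite !mxE -[i == _](inj_eq (@perm_inj _ s)).
rewrite permKV eq_sym.
have [<-|_] := eqVneq; last by rewrite !mul0r rmorph0.
by rewrite permK !mul1r.
Qed.

Lemma mon_conj s t f g :
  mon s f *m mon t g *m (mon s f)^t* =
  mon (t ^ s)%g (fun j => let i := (s^-1)%g j in f (t i) * g i * ((f i)^*)%R).
Proof. by rewrite mon_adj !mon_mul; apply: mon_ext => j /=. Qed.

Lemma mon1 : mon 1%g (fun=> 1) = 1%:M.
Proof. by apply/matrixP => i j; rewrite !mxE perm1 mulr1. Qed.

Lemma scale_mon c s f : c *: mon s f = mon s (fun j => c * f j).
Proof. by apply/matrixP => i j; rewrite !mxE mulrCA. Qed.

Lemma mon_unitary s f : (forall j, `|f j| = 1) -> mon s f \is unitarymx.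
Proof.
move=> f1; apply/unitarymxP; rewrite mon_adj mon_mul mulVg -mon1.
by apply: mon_ext => j; rewrite -normCK f1 expr1n.
Qed.

Lemma perm_mx_mon s : perm_mx s = mon (s^-1)%g (fun=> 1).
Proof.
apply/matrixP => i j; rewrite !mxE mulr1.
by rewrite -[i == _ in RHS](inj_eq (@perm_inj _ s)) permKV.
Qed.

(** The entry at [(s j, j)] is the nonzero [f j], so the other matrix must have its support there as
    well. *)
Lemma mon_inj c s t f g : c != 0 -> (forall j, f j != 0) ->
  mon s f = c *: mon t g -> s = t /\ forall j, f j = c * g j.
Proof.
move=> c0 f0; rewrite scale_mon => /matrixP eq_st.
have eq_s j : s j = t j.
  have := eq_st (s j) j; rewrite !mxE eqxx mul1r.
  by case: eqP => // _ /eqP; rewrite mul0r (negPf (f0 j)).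
split=> [|j]; first exact/permP.
by have := eq_st (s j) j; rewrite !mxE eq_s !eqxx !mul1r.
Qed.

End Monomial.

(** * Normal forms of Pauli strings *)

Section Pauli.
Variable R : realType.
Notation C := (R[i]).

(** The matrix X^a Z^b. *)
Definition pauli2 (a b : 'I_2) : 'M[C]_2 :=
  \matrix_(i, j) ((i == j + a)%:R * (-1) ^+ (b * j)%N).

(** The sign arises from moving Z^b past X^a'. *)
Lemma pauli2M a b a' b' :
  pauli2 a b *m pauli2 a' b' =
  (-1) ^+ (b * a')%N *: pauli2 (a + a') (b + b').
Proof.
apply/matrixP => i j; rewrite !mxE (bigD1 (j + a')) //= big1 => [|k neq_k].
  rewrite !mxE eqxx mul1r addr0 -mulrA [RHS]mulrCA -addrA (addrC a').
  congr (_ * _).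
  rewrite -!exprD -[LHS]signr_odd -[RHS]signr_odd; congr (_ ^+ nat_of_bool _).
  by move: b a' b' j => [[|[]]//?] [[|[]]//?] [[|[]]//?] [[|[]]//?].
by rewrite !mxE (negPf neq_k) mul0r mulr0.
Qed.

Lemma pauli2_0 : pauli2 0 0 = 1%:M.
Proof. by apply/matrixP => i j; rewrite !mxE addr0 mul0n mulr1. Qed.

Lemma pauliX_pauli2 : pauliX R = pauli2 1 0.
Proof.
apply/matrixP => i j; rewrite !mxE mul0n mulr1.
by move: i j => [[|[]]//?] [[|[]]//?].
Qed.

Lemma pauliZ_pauli2 : pauliZ R = pauli2 0 1.
Proof.
apply/matrixP => i j; rewrite !mxE addr0 -[LHS]mulr_natl.
have [->|_] := eqVneq i j; last by rewrite !mul0r.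
by congr (_ * _ ^+ _); rewrite -[LHS]mul1n.
Qed.

Lemma pauli2K a b : pauli2 a b *m ((-1) ^+ (b * a)%N *: pauli2 a b) = 1%:M.
Proof.
rewrite -scalemxAr pauli2M scalerA -exprD addnn -mul2n exprM sqrrN !expr1n.
by rewrite !I2_addxx pauli2_0 scale1r.
Qed.

Lemma pauli2_unit a b : pauli2 a b \in unitmx.
Proof. by have [] := mulmx1_unit (pauli2K a b). Qed.

Lemma invmx_pauli2 a b : invmx (pauli2 a b) = (-1) ^+ (b * a)%N *: pauli2 a b.
Proof. by rewrite -[RHS](mulKmx (pauli2_unit a b)) pauli2K mulmx1. Qed.

(** X and Z anticommute and square to one, so every word in the generators collapses to some X^a Z^b
    up to phase. *)
Lemma pauli1_phase (p : 'M[C]_2) : pauli1 p ->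
  exists c a b, `|c| = 1 /\ p = c *: pauli2 a b.
Proof.
elim=> [||||p1 p2 _ [c [a [b [c1 ->]]]] _ [d [a' [b' [d1 ->]]]]|
        p1 _ [c [a [b [c1 ->]]]]].
- by exists 1, 0, 0; rewrite normr1 pauli2_0 scale1r.
- by exists 'i, 0, 0; rewrite normCi pauli2_0 scalemx1.
- by exists 1, 1, 0; rewrite normr1 pauliX_pauli2 scale1r.
- by exists 1, 0, 1; rewrite normr1 pauliZ_pauli2 scale1r.
- exists (c * d * (-1) ^+ (b * a')%N), (a + a'), (b + b').
  rewrite !normrM c1 d1 normrX normrN1 expr1n !mulr1; split=> //.
  by rewrite -scalemxAl -scalemxAr pauli2M !scalerA.
- exists (c^-1 * (-1) ^+ (b * a)%N), a, b.
  rewrite normrM normfV c1 invr1 normrX normrN1 expr1n mulr1; split=> //.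
  have c_unit : c \is a GRing.unit by rewrite unitfE -normr_eq0 c1 oner_eq0.
  by rewrite invmxZ ?unitmxZ ?pauli2_unit // invmx_pauli2 scalerA.
Qed.

Lemma pauli1_pauli2 a b : pauli1 (pauli2 a b).
Proof.
have X : pauli1 (pauli2 1 0) by rewrite -pauliX_pauli2; constructor.
have Z : pauli1 (pauli2 0 1) by rewrite -pauliZ_pauli2; constructor.
have XZ : pauli1 (pauli2 1 1).
  have := Pauli1_mul X Z; rewrite pauli2M mul0n expr0 scale1r.
  by rewrite addr0 add0r.
have O : pauli1 (pauli2 0 0) by rewrite pauli2_0; constructor.
have I2 (x : 'I_2) : x = 0 \/ x = 1.
  by move: x => [[|[]]//?]; [left|right]; apply: val_inj.
by case: (I2 a) => ->; case: (I2 b) => ->.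
Qed.

Variable n : nat.
Implicit Types (a b : {ffun 'I_n -> 'I_2}) (p : 'M[C]_(2 ^ n)).

Definition pauliXZ a b : 'M[C]_(2 ^ n) :=
  mon (shift a) (fun j => (chi b (bits j))%:~R).

Lemma tensn_pauli2 a b : tensn (fun q => pauli2 (a q) (b q)) = pauliXZ a b.
Proof.
apply/matrixP => i j; rewrite tensn_prod mxE rmorph_prod.
under eq_bigr do rewrite mxE.
rewrite big_split /=; congr (_ * _); last first.
  by apply: eq_bigr => q _; rewrite rmorphXn rmorphN1 ffunE.
have [->|neq] := eqVneq.
  apply: big1 => q _; have /ffunP/(_ q) := bits_shift a j.
  by rewrite !ffunE => ->; rewrite eqxx.
suff [q neq_q] : exists q, bit i q != bit j q + a q.
  by rewrite (bigD1 q) //= (negPf neq_q) mul0r.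
apply/existsP; apply: contra_neqT neq => /existsPn eq_q.
apply: bits_inj; rewrite bits_shift; apply/ffunP => q; rewrite !ffunE.
by apply/eqP; have := eq_q q; rewrite negbK.
Qed.

Lemma pauli_pauliXZ a b : pauli (pauliXZ a b).
Proof.
exists (fun q => pauli2 (a q) (b q)); last by rewrite tensn_pauli2.
by move=> q; apply: pauli1_pauli2.
Qed.

Lemma pauli_phase p : pauli p ->
  exists c a b, `|c| = 1 /\ p = c *: pauliXZ a b.
Proof.
case=> s s_pauli ->.
have /choice[w wP] q : exists w : C * 'I_2 * 'I_2,
    `|w.1.1| = 1 /\ s q = w.1.1 *: pauli2 w.1.2 w.2.
  by have [c [a [b ?]]] := pauli1_phase (s_pauli q); exists (c, a, b).
exists (\prod_q (w q).1.1), [ffun q => (w q).1.2], [ffun q => (w q).2].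
split; first by rewrite normr_prod big1 // => q _; case: (wP q).
rewrite -tensn_pauli2; apply/matrixP => i j; rewrite mxE !tensn_prod -big_split.
by apply: eq_bigr => q _ /=; case: (wP q) => _ ->; rewrite mxE !ffunE.
Qed.

Lemma chi_phase b v : `|(chi b v)%:~R : C| = 1.
Proof. by rewrite -intr_norm chi_norm. Qed.

Lemma chi_neq0 b v : (chi b v)%:~R != 0 :> C.
Proof. by rewrite -normr_eq0 chi_phase oner_eq0. Qed.

Lemma pauliXZ_unitary a b : pauliXZ a b \is unitarymx.
Proof. by apply: mon_unitary => j; apply: chi_phase. Qed.

Lemma pauliXZ_inj c a b a' b' : c != 0 ->
  pauliXZ a b = c *: pauliXZ a' b' -> a = a' /\ b = b'.
Proof.
move=> c0 /(mon_inj c0 (fun j => chi_neq0 b (bits j)))[eq_sh eq_chi].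
split.
  have /permP/(_ (unbits 0))/(congr1 (@bits n)) := eq_sh.
  by rewrite !bits_shift unbitsK !add0r.
(* At the zero vector both characters equal 1, which isolates the scalar. *)
have c1 : c = 1.
  by have := eq_chi (unbits 0); rewrite unbitsK !chi0r mulr1.
apply: chi_inj => v; have := eq_chi (unbits v).
by rewrite unbitsK c1 mul1r => /intr_inj.
Qed.

(** Pauli strings commute up to the sign given by the symplectic form on the pairs [(a, b)] and
    [(a', b')]. *)
Lemma pauliXZ_conj a b a' b' :
  pauliXZ a b *m pauliXZ a' b' *m (pauliXZ a b)^t* =
  (chi b a' * chi b' a)%:~R *: pauliXZ a' b'.
Proof.
rewrite mon_conj scale_mon /pauliXZ.
have -> : (shift a' ^ shift a)%g = shift a'.
  by rewrite conjgE shiftV -!shiftD addrCA bitvec_addxx addr0.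
apply: mon_ext => j; rewrite /= shiftV !bits_shift rmorph_int -!rmorphM /=.
rewrite !chiDr; congr _%:~R.
transitivity ((chi b (bits j) * chi b (bits j)) * (chi b a * chi b a) *
              (chi b a' * chi b' a * chi b' (bits j))); first by ring.
by rewrite !chi_sqr !mul1r.
Qed.

End Pauli.

(** * The Clifford hierarchy *)

Lemma adj_mulmxV (C : numClosedFieldType) m (U : 'M[C]_m) :
  U \is unitarymx -> U^t* *m U = 1%:M.
Proof. by move=> U1; rewrite -invmx_unitary // mulVmx // unitarymx_unit. Qed.

Lemma conj_adjK (C : numClosedFieldType) m (U V : 'M[C]_m) :
  U \is unitarymx -> U^t* *m (U *m V *m U^t*) *m U = V.
Proof. by move=> U1; rewrite !mulmxA adj_mulmxV // mul1mx mulmxKtV. Qed.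

Section Hierarchy.
Variables (R : realType) (n : nat).
Notation C := (R[i]).
Implicit Types (U V W p : 'M[C]_(2 ^ n)) (c : C) (k : nat).
Implicit Types (a b : {ffun 'I_n -> 'I_2}).

Lemma adj_mulmx U V : (U *m V)^t* = V^t* *m U^t*.
Proof. by rewrite trmx_mul map_mxM. Qed.

Lemma adj_scale c U : (c *: U)^t* = (c^*)%R *: U^t*.
Proof. by apply/matrixP => i j; rewrite !mxE rmorphM. Qed.

Lemma conj_mulmx U V W :
  (U *m V) *m W *m (U *m V)^t* = U *m (V *m W *m V^t*) *m U^t*.
Proof. by rewrite adj_mulmx !mulmxA. Qed.

Lemma conj_scalel c U V : `|c| = 1 ->
  (c *: U) *m V *m (c *: U)^t* = U *m V *m U^t*.
Proof.
move=> c1; rewrite adj_scale -!scalemxAl -scalemxAr scalerA.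
by rewrite -normCK c1 expr1n scale1r.
Qed.

Lemma conj_scaler c U V : U *m (c *: V) *m U^t* = c *: (U *m V *m U^t*).
Proof. by rewrite -scalemxAr -scalemxAl. Qed.

Lemma scale_unitary c U : `|c| = 1 -> U \is unitarymx -> c *: U \is unitarymx.
Proof.
move=> c1 /unitarymxP UU; apply/unitarymxP.
by have := conj_scalel U 1%:M c1; rewrite !mulmx1 UU.
Qed.

Lemma phase_neq0 c : `|c| = 1 -> c != 0.
Proof. by move=> c1; rewrite -normr_eq0 c1 oner_eq0. Qed.

Lemma phaseV c : `|c| = 1 -> `|c^-1| = 1.
Proof. by move=> c1; rewrite normfV c1 invr1. Qed.

Lemma CHlevel1P U :
  CHlevel 1 U <-> exists c a b, `|c| = 1 /\ U = c *: pauliXZ R a b.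
Proof.
split=> [[p /pauli_phase[c [a [b [c1 ->]]]] [d d1 ->]]|[c [a [b [c1 ->]]]]].
  by exists (d * c), a, b; rewrite normrM c1 d1 mulr1 scalerA.
by exists (pauliXZ R a b); [apply: pauli_pauliXZ | exists c].
Qed.

Lemma CHlevel_unitary k U : CHlevel k U -> U \is unitarymx.
Proof.
case: k => [//|[|k]]; last by case.
move=> /CHlevel1P[c [a [b [c1 ->]]]].
by rewrite scale_unitary // pauliXZ_unitary.
Qed.

Lemma CHlevel_scale k c U : `|c| = 1 -> CHlevel k U -> CHlevel k (c *: U).
Proof.
move=> c1; case: k => [//|[|k]].
  move=> /CHlevel1P[d [a [b [d1 ->]]]]; apply/CHlevel1P.
  by exists (c * d), a, b; rewrite normrM c1 d1 mulr1 scalerA.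
move=> [U1 U2]; split; first exact: scale_unitary.
by move=> p p1; rewrite conj_scalel //; apply: U2.
Qed.

Lemma CHlevelSP k U :
  CHlevel k.+2 U <-> U \is unitarymx /\
    forall a b, CHlevel k.+1 (U *m pauliXZ R a b *m U^t*).
Proof.
split=> -[U1 U2]; split=> //.
  by move=> a b; apply: U2; apply: pauli_pauliXZ.
move=> p /pauli_phase[c [a [b [c1 ->]]]]; rewrite conj_scaler.
exact: CHlevel_scale (U2 a b).
Qed.

(** The base case says that Pauli gates are Clifford: they conjugate Pauli strings to themselves up
    to sign. Higher levels inherit the inclusion through their conjugates. *)
Lemma CHlevelS k U : CHlevel k U -> CHlevel k.+1 U.
Proof.
elim: k => [//|[|k] IHk] in U *.
  move=> Up; apply/CHlevelSP; split; first exact: CHlevel_unitary Up.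
  case/CHlevel1P: Up => c [a [b [c1 ->]]] a' b'.
  rewrite conj_scalel // pauliXZ_conj; apply/CHlevel1P.
  exists (chi b a' * chi b' a)%:~R, a', b'; split=> //.
  by rewrite rmorphM normrM !chi_phase mulr1.
move=> /(CHlevelSP k)[U1 U2]; apply/(CHlevelSP k.+1).
by split=> [|a b]; [exact: U1 | exact: IHk (U2 a b)].
Qed.

Lemma CHlevel_le k l U : (k <= l)%N -> CHlevel k U -> CHlevel l U.
Proof.
move=> /subnK <- Uk; elim: (l - k)%N => // m; rewrite addSn; exact: CHlevelS.
Qed.

Lemma clifford_unitary U : clifford U -> U \is unitarymx.
Proof. exact: CHlevel_unitary. Qed.

(* Conjugation by a Clifford gate is injective on the finite set of Pauli
   strings up to phase, hence surjective. *)
Lemma clifford_adj U : clifford U -> clifford (U^t*).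
Proof.
move=> Ucl; have U1 := clifford_unitary Ucl.
have UV1 : U^t* \is unitarymx by rewrite trmxC_unitary.
have [_ UP] := (CHlevelSP 0 U).1 Ucl.
pose L : finType := ({ffun 'I_n -> 'I_2} * {ffun 'I_n -> 'I_2})%type.
have /choice[w wP] (l : L) : exists w : C * L,
    `|w.1| = 1 /\ U *m pauliXZ R l.1 l.2 *m U^t* = w.1 *: pauliXZ R w.2.1 w.2.2.
  have [c [a [b [c1 eqU]]]] := (CHlevel1P _).1 (UP l.1 l.2).
  by exists (c, (a, b)).
have UK V : U^t* *m (U *m V *m U^t*) *m U = V := conj_adjK V U1.
have w_inj : injective (fun l => (w l).2).
  move=> l l' eq_l; have [c1 eqc] := wP l; have [d1 eqd] := wP l'.
  have c0 := phase_neq0 d1; have: pauliXZ R l.1 l.2 =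
      ((w l).1 * (w l').1^-1) *: pauliXZ R l'.1 l'.2.
    rewrite -[LHS]UK eqc -[pauliXZ R l'.1 _]UK eqd eq_l.
    by rewrite -!scalemxAr -!scalemxAl !scalerA mulfVK.
  move/pauliXZ_inj; rewrite mulf_neq0 ?invr_eq0 ?phase_neq0 // => /(_ isT)[].
  by case: (l) (l') => ? ? [? ?] /= -> ->.
apply/CHlevelSP; split=> // a b; apply/CHlevel1P.
have [g _ gK] := injF_bij w_inj; have [c1] := wP (g (a, b)).
have -> : (w (g (a, b))).2 = (a, b) := gK (a, b); rewrite /= => eqU.
exists ((w (g (a, b))).1^-1), (g (a, b)).1, (g (a, b)).2.
split; first exact: phaseV.
apply: (scalerI (phase_neq0 c1)); rewrite trmxCK scalerA divff ?phase_neq0 //.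
by rewrite scale1r -[RHS]UK eqU -!scalemxAr -!scalemxAl.
Qed.

Lemma clifford_pauli U a b : clifford U ->
  exists c a' b', `|c| = 1 /\
    U *m pauliXZ R a b *m U^t* = c *: pauliXZ R a' b'.
Proof. by move=> /(CHlevelSP 0)[_ /(_ a b)/CHlevel1P]. Qed.

(** [V] only permutes the Pauli strings, up to phase, before [U] conjugates them. The levels start
    at 2 because Pauli gates are not stable under Clifford factors. *)
Lemma CHlevel_mulr k U V :
  clifford V -> CHlevel k.+2 U -> CHlevel k.+2 (U *m V).
Proof.
move=> Vcl /CHlevelSP[U1 U2]; apply/CHlevelSP; split.
  by rewrite mul_unitarymx ?(clifford_unitary Vcl).
move=> a b; have [c [a' [b' [c1 eqV]]]] := clifford_pauli a b Vcl.
by rewrite conj_mulmx eqV conj_scaler; apply: CHlevel_scale.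
Qed.

Lemma CHlevel_conj k U V : clifford V -> CHlevel k U ->
  CHlevel k (V *m U *m V^t*).
Proof.
move=> Vcl; have V1 := clifford_unitary Vcl.
case: k => [//|k]; elim: k => [|k IHk] in U *.
  move=> /CHlevel1P[c [a [b [c1 ->]]]]; rewrite conj_scaler.
  by apply: CHlevel_scale => //; have [_] := (CHlevelSP 0 V).1 Vcl.
move=> UC; apply: CHlevel_mulr; first exact: clifford_adj.
have /CHlevelSP[U1 U2] := UC; apply/CHlevelSP; split.
  exact: mul_unitarymx V1 U1.
by move=> a b; rewrite conj_mulmx; apply: IHk.
Qed.

Lemma CHlevel_mull k U V :
  clifford V -> CHlevel k.+2 U -> CHlevel k.+2 (V *m U).
Proof.
move=> Vcl /(CHlevel_conj Vcl)/(CHlevel_mulr Vcl).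
by rewrite mulmxKtV // (clifford_unitary Vcl).
Qed.

End Hierarchy.

(** * Monomial gates in the hierarchy *)

Section MonomialHierarchy.
Variables (R : realType) (n : nat).
Notation C := (R[i]).
Notation V := {ffun 'I_n -> 'I_2}.
Implicit Types (f g : 'I_(2 ^ n) -> C) (a b : V) (s : {perm 'I_(2 ^ n)}).

Lemma expr2_le (x : C) k l : (k <= l)%N -> x ^+ (2 ^ k) = 1 -> x ^+ (2 ^ l) = 1.
Proof.
by move=> /subnKC <- x1; rewrite expnD exprM x1 expr1n.
Qed.

Lemma norm_root1 (x : C) k : x ^+ (2 ^ k) = 1 -> `|x| = 1.
Proof.
move=> /(congr1 Num.norm)/eqP; rewrite normrX normr1.
by rewrite pexpr_eq1 ?expn_gt0 // => /eqP.
Qed.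

Lemma CHlevel_pauliXZ k a b : CHlevel k.+1 (pauliXZ R a b).
Proof.
apply: (@CHlevel_le _ _ 1) => //; apply/CHlevel1P.
by exists 1, a, b; rewrite normr1 scale1r.
Qed.

Lemma CHlevel_id k : CHlevel k.+1 (1%:M : 'M[C]_(2 ^ n)).
Proof.
suff <- : pauliXZ R (0 : V) (0 : V) = 1%:M by apply: CHlevel_pauliXZ.
rewrite -mon1 /pauliXZ shift0.
by apply: mon_ext => j; rewrite chi0l.
Qed.

Definition shift_quot a f j := f (shift a j) / f j.

Lemma diag_conj f a b : (forall j, `|f j| = 1) ->
  mon 1%g f *m pauliXZ R a b *m (mon 1%g f)^t* =
  pauliXZ R a b *m mon 1%g (shift_quot a f).
Proof.
move=> f1; rewrite mon_conj conjg1 mon_mul mul1g.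
apply: mon_ext => j; rewrite /= invg1 !perm1 /shift_quot.
have -> : ((f j)^*)%R = (f j)^-1 by rewrite invC_norm f1 expr1n invr1 mul1r.
by rewrite -mulrA mulrCA.
Qed.

(* [shift_quot a (shift_quot a f)] is the inverse square of [shift_quot a f], so
   each step lowers the order of one of the finitely many quotients. *)
Lemma CHlevel_diag k (e : V -> nat) f :
    (\sum_a e a <= k)%N -> (forall j, `|f j| = 1) ->
    (forall a j, shift_quot a f j ^+ (2 ^ e a) = 1) ->
  CHlevel k.+2 (mon 1%g f).
Proof.
elim: k => [|k IHk] in e f *; move=> e_le f1 fe.
  have {}fe j : f j = f (unbits 0).
    have e0 : e (bits j - bits (unbits 0)) = 0%N.
      apply/eqP; rewrite -leqn0 (leq_trans _ e_le) //.
      by rewrite (bigD1 (bits j - bits (unbits 0))) //= leq_addr.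
    have := fe (bits j - bits (unbits 0)) (unbits 0).
    rewrite e0 expr1 /shift_quot shift_bits.
    move=> /(canRL (divfK (phase_neq0 (f1 _)))).
    by rewrite mul1r.
  have -> : mon 1%g f = f (unbits 0) *: 1%:M.
    by rewrite -mon1 scale_mon; apply: mon_ext => j; rewrite mulr1.
  by apply: CHlevel_scale => //; apply: CHlevel_id.
apply/CHlevelSP; split=> [|a b]; first exact: mon_unitary.
rewrite diag_conj //; apply: CHlevel_mull; first exact: CHlevel_pauliXZ.
have f0 j : f j != 0 := phase_neq0 (f1 j).
have [ea0|ea_gt0] := posnP (e a).
  suff -> : mon 1%g (shift_quot a f) = 1%:M by apply: CHlevel_id.
  by rewrite -mon1; apply: mon_ext => j; rewrite -(fe a j) ea0 expr1.
apply: (IHk (fun c => if c == a then (e a).-1 else e c)) => [|j|c j].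
- rewrite -ltnS (leq_trans _ e_le) // (bigD1 a) // [X in (_ < X)%N](bigD1 a) //=.
  rewrite eqxx -addSn prednK // leq_add2l leq_sum // => c /negPf -> //.
- by rewrite normrM normfV !f1 divr1.
have [->|_] := eqVneq c a.
  have -> : shift_quot a (shift_quot a f) j = (shift_quot a f j ^+ 2)^-1.
    by rewrite /shift_quot shiftK; field; rewrite !f0.
  by rewrite exprVn -exprM -expnS prednK // fe invr1.
(* Quotients in two directions commute, so in any direction other than [a] the exponent bound
   survives unchanged. *)
have -> : shift_quot c (shift_quot a f) j =
          shift_quot c f (shift a j) / shift_quot c f j.
  by rewrite /shift_quot (shiftC c a); field; rewrite !f0.
by rewrite expr_div_n !fe divr1.
Qed.

Lemma CHlevel_dyadic_diag m f : (forall j, f j ^+ (2 ^ m) = 1) ->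
  CHlevel (#|{: V}| * m).+2 (mon 1%g f).
Proof.
move=> fm; apply: (@CHlevel_diag _ (fun=> m)) => [|j|a j].
- by rewrite sum_nat_const.
- exact: norm_root1 (fm j).
- by rewrite /shift_quot expr_div_n !fm divr1.
Qed.

Lemma mon_split s f : mon s f = mon s (fun=> 1) *m mon 1%g f.
Proof. by rewrite mon_mul mul1g; apply: mon_ext => j; rewrite mul1r. Qed.

Lemma perm_conj s a :
  mon s (fun=> 1) *m pauliXZ R a 0 *m (mon s (fun=> 1))^t* =
  mon (shift a ^ s)%g (fun=> 1).
Proof.
rewrite mon_conj; apply: mon_ext => j /=.
by rewrite chi0l !rmorph1 !mulr1.
Qed.

(** The exponent is [m.+1] so that the signs contributed by the Z part of a Pauli string are roots
    of unity of the same order, and the induction closes. *)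
Lemma CHlevel_perm_dyadic k m s f :
    CHlevel k.+1 (mon s (fun=> 1 : C)) -> (forall j, f j ^+ (2 ^ m.+1) = 1) ->
  CHlevel (k + #|{: V}| * m.+1).+2 (mon s f).
Proof.
elim: k => [|k IHk] in s f *; move=> sC fm.
  rewrite mon_split; have [c [a [b [c1 ->]]]] := (CHlevel1P _).1 sC.
  rewrite -scalemxAl; apply: CHlevel_scale => //.
  apply: CHlevel_mull; first exact: CHlevel_pauliXZ.
  exact: CHlevel_dyadic_diag.
rewrite addSn; apply/CHlevelSP; split=> [|a b].
  by apply: mon_unitary => j; apply: norm_root1 (fm j).
rewrite mon_conj; apply: IHk => [|j /=].
  by rewrite -perm_conj; have [_] := (CHlevelSP k _).1 sC.
rewrite !exprMn -!rmorphXn /= !fm rmorph1 mulr1 mul1r.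
by rewrite expnS exprM expr2 chi_sqr expr1n.
Qed.

Lemma CHlevel_mon k s f : (forall j, `|f j| = 1) -> CHlevel k.+1 (mon s f) ->
  CH (mon s (fun=> 1 : C)) /\ exists m, forall i j, (f i / f j) ^+ (2 ^ m) = 1.
Proof.
elim: k => [|k IHk] in s f *; move=> f1 sC.
  have [c [a [b [c1]]]] := (CHlevel1P _).1 sC.
  have f0 j : f j != 0 := phase_neq0 (f1 j).
  move=> /(mon_inj (phase_neq0 c1) f0)[-> eq_f]; split.
    exists 1%N => //; suff -> : mon (shift a) (fun=> 1 : C) = pauliXZ R a 0.
      exact: CHlevel_pauliXZ.
    by apply: mon_ext => j; rewrite chi0l.
  exists 1%N => i j; rewrite !eq_f -mulf_div divff ?phase_neq0 // mul1r.
  by rewrite expr_div_n -!rmorphXn /= !expr2 !chi_sqr divr1.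
have f0 j : f j != 0 := phase_neq0 (f1 j).
have /choice[w wP] a : exists w : nat * nat,
    CHlevel w.1 (mon (shift a ^ s)%g (fun=> 1 : C)) /\
    forall i j, (shift_quot a f i / shift_quot a f j) ^+ (2 ^ w.2) = 1.
  (* The X strings, with [b = 0], already expose both the conjugated shift and the quotients of
     [f]. *)
  have [_ /(_ a 0)] := (CHlevelSP k _).1 sC.
  rewrite mon_conj => /IHk[j /=|[l _ lC] [m mP]].
    by rewrite chi0l rmorph1 mulr1 normrM norm_conjC !f1 mulr1.
  exists (l, m); split=> // i j; have := mP (s i) (s j).
  have fV x : ((f x)^*)%R = (f x)^-1 by rewrite invC_norm f1 expr1n invr1 mul1r.
  by rewrite /= !permK !chi0l !rmorph1 !mulr1 !fV.
pose l := (\max_a (w a).1)%N; pose m := (\max_a (w a).2)%N; split.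
  (* Conjugating X^a Z^b by the permutation gives a conjugated shift, of level at most [l], times a
     diagonal of signs. [CHlevel_perm_dyadic] with exponent [2 ^ 1] bounds its level, and the
     permutation itself is one level higher. *)
  exists (l + #|{: V}| * 1).+3 => //.
  apply/CHlevelSP; split=> [|a b].
    by apply: mon_unitary => j; rewrite normr1.
  rewrite mon_conj; apply: (@CHlevel_perm_dyadic _ 0) => [|j /=].
    have [+ _] := wP a; apply: CHlevel_le; apply: leqW; exact: leq_bigmax.
  by rewrite rmorph1 mulr1 mul1r -rmorphXn /= expr2 chi_sqr.
(* The direction is chosen so that its shift swaps [i] and [j]; the quotient of the two entries is
   then an inverse square of [f i / f j], which costs one more doubling. *)
exists m.+1 => i j; have [_ /(_ i j)] := wP (bits j - bits i).
set a := bits j - bits i.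
have ai : shift a i = j := shift_bits i j.
have aj : shift a j = i by rewrite -ai shiftK.
have -> : shift_quot a f i / shift_quot a f j = ((f i / f j) ^+ 2)^-1.
  rewrite /shift_quot ai aj.
  by field; rewrite !f0.
have le_m : ((w a).2 <= m)%N by apply: leq_bigmax.
move=> /(expr2_le le_m).
by rewrite exprVn -exprM -expnS => /eqP; rewrite invr_eq1 => /eqP.
Qed.

End MonomialHierarchy.

(** * Rotations generated by Z strings *)

Section DiagonalExponential.
Variable C : numClosedFieldType.

(** A neighbourhood of [A] contains an entrywise product of neighbourhoods, and finitely many
    eventual conditions eventually hold together. *)
Lemma cvg_mx (m : nat) (F : nat -> 'M[C]_m) (A : 'M[C]_m) :
  (forall i j, F k i j @[k --> \oo] --> A i j) -> F @ \oo --> A.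
Proof.
move=> FA U [P PA sPU].
have FP : \forall k \near \oo,
    forall ij : 'I_m * 'I_m, P ij.1 ij.2 (F k ij.1 ij.2).
  by apply: filter_forall => -[i j]; apply: FA; apply: PA.
by apply: filterS FP => k FPk; apply: sPU => i j; apply: (FPk (i, j)).
Qed.

Lemma expmx_lim (m : nat) (A B : 'M[C]_m) :
  (forall i j,
    \sum_(0 <= k < N) (k`!%:R^-1 *: A ^+ k) i j @[N --> \oo] --> B i j) ->
  expmx A = B.
Proof.
move=> AB; apply: (cvg_lim (@norm_hausdorff _ 'M[C]_m)).
apply: cvg_mx => i j; rewrite /series /=.
by under eq_fun do rewrite summxE; apply: AB.
Qed.

Lemma mon_exp (m k : nat) (f : 'I_m -> C) :
  mon 1%g f ^+ k = mon 1%g (fun j => f j ^+ k).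
Proof.
elim: k => [|k IHk].
  by rewrite expr0 -[LHS]mon1; apply: mon_ext => j; rewrite expr0.
rewrite exprS IHk [LHS]mon_mul mulg1.
by apply: mon_ext => j; rewrite perm1 exprS.
Qed.

Lemma expmx_diag (m : nat) (f l : 'I_m -> C) :
  (forall j, \sum_(0 <= k < N) k`!%:R^-1 * f j ^+ k @[N --> \oo] --> l j) ->
  expmx (mon 1%g f) = mon 1%g l.
Proof.
move=> fl; apply: expmx_lim => i j.
under eq_fun do under eq_bigr do rewrite mon_exp scale_mon mxE.
rewrite mxE perm1; have [_|_] := eqVneq.
  rewrite mul1r; under eq_fun do under eq_bigr do rewrite mul1r.
  exact: fl.
rewrite mul0r; under eq_fun do under eq_bigr do rewrite mul0r.
have -> : (fun N => \sum_(0 <= k < N) (0 : C)) = fun=> 0.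
  by apply/funext => N; rewrite big1.
exact: cvg_cst.
Qed.

(** The bridge from norm estimates, the form in which the series is controlled over [R[i]], to
    convergence. *)
Lemma cvg_dist (u : nat -> C) (l : C) :
  (forall e, 0 < e -> \forall k \near \oo, `|l - u k| < e) -> u @ \oo --> l.
Proof. by move=> ul; apply/cvgrPdist_lt. Qed.

End DiagonalExponential.

(** * The complex exponential on the imaginary axis and dyadic roots of unity *)

Section ComplexExponential.
Variable R : realType.
Notation C := (R[i]).
Implicit Type t : R.

Definition cis t : C := (cos t)%:C + 'i * (sin t)%:C.

Lemma norm_real_complex (x : R) : `|x%:C| = (`|x|)%:C.
Proof. by rewrite normc_def /= expr0n addr0 sqrtr_sqr. Qed.

(** The parity factors and halved exponents are those of [cos_coeff] and [sin_coeff], so the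
    exponential series splits term by term. *)
Lemma imaginary_exp k :
  ('i : C) ^+ k =
  (~~ odd k)%:R * (-1) ^+ k./2 + 'i * ((odd k)%:R * (-1) ^+ k.-1./2).
Proof.
rewrite -[k]odd_double_half; move: (odd k) (k./2) => [] j.
  rewrite add1n /= odd_double doubleK exprS -mul2n exprM sqrCi.
  by rewrite mul0r add0r mul1r.
rewrite add0n odd_double doubleK -mul2n exprM sqrCi.
by rewrite mul0r mulr0 addr0 mul1r.
Qed.

Lemma cis_coeff t k : k`!%:R^-1 * ('i * t%:C) ^+ k =
  (cos_coeff t k)%:C + 'i * (sin_coeff t k)%:C.
Proof.
rewrite /cos_coeff /sin_coeff /= exprMn imaginary_exp.
rewrite !rmorphM /= !fmorphV /= !rmorph_nat !rmorphXn /= !rmorphN1.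
by ring.
Qed.

(* Stated with norms because no topology is inferred directly on [R[i]]. *)
Lemma cis_series_near t (e : C) : 0 < e ->
  \forall N \near \oo,
    `|cis t - \sum_(0 <= k < N) k`!%:R^-1 * ('i * t%:C) ^+ k| < e.
Proof.
(* Positivity in the order of [R[i]] forces [e] to be real; half of it is granted to each of the
   cosine and sine series. *)
move=> e0; have [r r0 er] : exists2 r : R, 0 < r & e = r%:C + r%:C.
  move: e0; rewrite ltcE /= => /andP[/eqP e_im e_re].
  exists (complex.Re e / 2); first by rewrite divr_gt0.
  by rewrite -rmorphD /= -splitr; apply/eqP; rewrite eq_complex /= e_im !eqxx.
have cosN : series (cos_coeff t) @ \oo --> cos t.
  by rewrite unlock; apply: is_cvg_series_cos_coeff.
have sinN : series (sin_coeff t) @ \oo --> sin t.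
  by rewrite unlock; apply: is_cvg_series_sin_coeff.
move/cvgrPdist_lt: cosN => /(_ r r0) cosN.
move/cvgrPdist_lt: sinN => /(_ r r0) sinN.
near=> N.
have -> : \sum_(0 <= k < N) k`!%:R^-1 * ('i * t%:C) ^+ k =
    (series (cos_coeff t) N)%:C + 'i * (series (sin_coeff t) N)%:C.
  under eq_bigr do rewrite cis_coeff.
  by rewrite big_split /= -mulr_sumr -!rmorph_sum.
rewrite er /cis opprD addrACA -mulrBr -!rmorphB /=.
apply: le_lt_trans (ler_normD _ _) _; rewrite normrM normCi mul1r.
rewrite !norm_real_complex ltrD // ltcR.
  by near: N.
by near: N.
Unshelve. all: by end_near. Qed.

Lemma expmx_cis (N : nat) (f : 'I_N -> R) :
  expmx (mon 1%g (fun j => 'i * (f j)%:C)) = mon 1%g (fun j => cis (f j)).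
Proof.
by apply: expmx_diag => j; apply: cvg_dist => e; apply: cis_series_near.
Qed.

Lemma cisD s t : cis (s + t) = cis s * cis t.
Proof.
rewrite /cis cosD sinD rmorphB !rmorphD /= !rmorphM /=.
transitivity ((cos s)%:C * (cos t)%:C + 'i ^+ 2 * (sin s)%:C * (sin t)%:C +
  'i * ((sin s)%:C * (cos t)%:C + (cos s)%:C * (sin t)%:C)); last by ring.
by rewrite sqrCi !mulN1r mulNr.
Qed.

Lemma cis0 : cis 0 = 1.
Proof. by rewrite /cis cos0 sin0 rmorph1 rmorph0 mulr0 addr0. Qed.

Lemma cispi : cis pi = -1.
Proof. by rewrite /cis cospi sinpi rmorph0 mulr0 addr0 rmorphN1. Qed.

Lemma cisMn t k : cis (t *+ k) = cis t ^+ k.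
Proof.
by elim: k => [|k IHk]; rewrite ?mulr0n ?cis0 ?expr0 // mulrS cisD IHk exprS.
Qed.

Lemma cis_sum (I : finType) (F : I -> R) : cis (\sum_i F i) = \prod_i cis (F i).
Proof. by elim/big_rec2: _ => [|i x y _ <-]; rewrite ?cis0 ?cisD. Qed.

Lemma cis_norm t : `|cis t| = 1.
Proof.
have cisE : cis t = cos t +i* sin t.
  apply/eqP; rewrite eq_complex /=.
  by rewrite !(mul0r, mul1r, mulr0, addr0, add0r, subr0) !eqxx.
by rewrite cisE normc_def /= cos2Dsin2 sqrtr1.
Qed.

Lemma cisN t : cis (- t) = (cis t)^-1.
Proof.
have := cisD t (- t); rewrite subrr cis0 => tN.
apply: (mulfI (phase_neq0 (cis_norm t))).
by rewrite -tN divff ?phase_neq0 ?cis_norm.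
Qed.

Lemma cis_dyadic (a : int) k : cis (a%:~R * pi / 2 ^+ k) ^+ (2 ^ k.+1) = 1.
Proof.
rewrite -cisMn -[X in cis X]mulr_natr natrX exprSr mulrA.
rewrite divfK ?expf_neq0 ?pnatr_eq0 //.
rewrite -mulrA mulrzl.
have cis2pi j : cis (pi * 2 *+ j) = 1.
  by rewrite cisMn mulr_natr cisMn cispi sqrrN expr1n expr1n.
by case: a => j; rewrite ?NegzE ?mulrNz ?cisN -pmulrn cis2pi ?invr1.
Qed.

Lemma root_cis k (x : C) : x ^+ (2 ^ k) = 1 ->
  exists t : nat, x = cis (t%:R * (pi * 2 / 2 ^+ k)).
Proof.
move=> x1; pose w := cis (pi * 2 / 2 ^+ k).
have wn : w ^+ (2 ^ k) = 1.
  rewrite -cisMn -[X in cis X]mulr_natr natrX divfK ?expf_neq0 ?pnatr_eq0 //.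
  by rewrite mulr_natr cisMn cispi sqrrN expr1n.
have w_prim : (2 ^ k).-primitive_root w.
  have [|m wm m_dvd] := prim_order_exists _ wn; first by rewrite expn_gt0.
  have /(@dvdn_pfactor 2)[//|j j_le mE] := m_dvd.
  move: j_le; rewrite leq_eqVlt => /predU1P[<-|]; first by rewrite -mE.
  (* If the order were a proper divisor of the power of two, raising [w] to half that power would
     give 1, but it gives exp(i pi) = -1. *)
  case: k => // k in w {wn m_dvd x1} wm *; rewrite ltnS => j_le.
  have : w ^+ (2 ^ k) = 1.
    by apply/eqP; rewrite -(prim_order_dvd wm) mE dvdn_exp2l.
  have -> : w ^+ (2 ^ k) = -1.
    rewrite -cisMn -[X in cis X]mulr_natr natrX exprS -cispi; congr cis.
    by field; rewrite expf_neq0 ?pnatr_eq0.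
  by move/eqP; rewrite -subr_eq0 -opprD oppr_eq0 -mulr2n pnatr_eq0.
have [[t /= _] ->] := prim_rootP w_prim x1.
by exists t; rewrite -cisMn mulr_natl.
Qed.

End ComplexExponential.

(** * Dyadic diagonals and the Walsh-Hadamard transform *)

Section DyadicDiagonals.
Variables (R : realType) (n : nat).
Notation C := (R[i]).
Implicit Types (S : {set 'I_n}) (f : 'I_(2 ^ n) -> C).

Definition chis S (j : 'I_(2 ^ n)) : int :=
  chi [ffun q => if q \in S then 1 else 0] (bits j).

Lemma zstring_mon S : zstring R S = mon 1%g (fun j => (chis S j)%:~R).
Proof.
transitivity (pauliXZ R 0 [ffun q => if q \in S then 1 else 0]).
  rewrite -tensn_pauli2; congr tensn; apply/funext => q; rewrite !ffunE.
  by case: ifP; rewrite ?pauliZ_pauli2 ?pauli2_0.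
by rewrite /pauliXZ shift0.
Qed.

Lemma zrot_mon (theta : R) S :
  zrot theta S = mon 1%g (fun j => cis (theta * (chis S j)%:~R)).
Proof.
rewrite -expmx_cis /zrot zstring_mon scale_mon; congr expmx.
by apply: mon_ext => j; rewrite -mulrA rmorphM /= rmorph_int.
Qed.

Lemma prod_zrot m (theta : 'I_m -> R) (S : 'I_m -> {set 'I_n}) :
  \prod_(j < m) zrot (theta j) (S j) =
  mon 1%g (fun i => cis (\sum_j theta j * (chis (S j) i)%:~R)).
Proof.
under eq_bigr do rewrite zrot_mon.
elim: m => [|m IHm] in theta S *.
  by rewrite big_ord0 -[LHS]mon1; apply: mon_ext => j; rewrite big_ord0 cis0.
rewrite big_ord_recl IHm [LHS]mon_mul mulg1; apply: mon_ext => j.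
by rewrite perm1 big_ord_recl cisD.
Qed.

(** The sum over subsets expands a product over qubits of factors 1 + (-1)^(v q), and one differing
    bit makes a factor vanish. *)
Lemma chis_orthogonal i j :
  \sum_S chis S i * chis S j = (i == j)%:R * (2 ^ n)%:R.
Proof.
pose v := bits i + bits j.
transitivity (\prod_q ((-1) ^+ v q + 1 : int)).
  rewrite bigA_distr; apply: eq_bigr => S _; rewrite /chis -chiDr -/v.
  by apply: eq_bigr => q _; rewrite ffunE; case: ifP; rewrite ?mul1n ?mul0n.
have [eq_ij|neq_ij] := eqVneq i j.
  rewrite /v eq_ij mul1r; under eq_bigr do rewrite ffunE I2_addxx.
  by rewrite prodr_const card_ord natrX.
suff [q vq] : exists q, (-1) ^+ v q + 1 = 0 :> int.
  by rewrite (bigD1 q) //= vq !mul0r.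
have /existsP[q neq_q] : [exists q, bits i q != bits j q].
  apply: contraNT neq_ij => /existsPn eq_ij; apply/eqP/bits_inj/ffunP => q.
  by apply/eqP; have := eq_ij q; rewrite negbK.
exists q; move: neq_q; rewrite /v [X in nat_of_ord X]ffunE.
by move: (bits i q) (bits j q) => [[|[]]//?] [[|[]]//?].
Qed.

Lemma chis_inversion (t : 'I_(2 ^ n) -> int) i :
  \sum_S (\sum_j t j * chis S j) * chis S i = t i * (2 ^ n)%:R.
Proof.
under eq_bigr do rewrite mulr_suml.
rewrite exchange_big (bigD1 i) //= [X in _ + X]big1 => [|j neq_j].
  by under eq_bigr do rewrite -mulrA;
    rewrite -mulr_sumr chis_orthogonal eqxx mul1r addr0.
by under eq_bigr do rewrite -mulrA;
  rewrite -mulr_sumr chis_orthogonal (negPf neq_j) mul0r mulr0.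
Qed.

(* The exponents are the Walsh-Hadamard transform of the phases of [f]. *)
Lemma dyadic_diag_prod_zrot k f : (forall j, f j ^+ (2 ^ k) = 1) ->
  exists (m : nat) (alpha : 'I_m -> int) (l : 'I_m -> nat)
         (S : 'I_m -> {set 'I_n}),
    (forall j, (0 < l j)%N) /\
    mon 1%g f = \prod_(j < m) zrot ((alpha j)%:~R * pi / 2 ^+ l j) (S j).
Proof.
move=> fk; have /choice[t tE] j := root_cis (fk j).
(* Inversion yields [2 ^ n] times the phase. The factor 4 over the denominator [2 ^ (k + n).+1]
   cancels this and leaves the angle [t j] times 2 pi / 2^k. *)
pose alpha S : int := \sum_j (t j * 4)%:R * chis S j.
exists #|{set 'I_n}|, (fun j => alpha (enum_val j)), (fun=> (k + n).+1).
exists enum_val.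
split=> //; rewrite prod_zrot; apply: mon_ext => i; rewrite tE; congr cis.
transitivity (\sum_S (alpha S * chis S i)%:~R * (pi / 2 ^+ (k + n).+1) : R).
  rewrite -mulr_suml -rmorph_sum /= chis_inversion !rmorphM /= !rmorph_nat.
  rewrite exprS exprD natrX; field.
  by rewrite !expf_neq0 ?pnatr_eq0.
rewrite (big_enum_val (A := {set 'I_n})) /=; apply: eq_bigr => j _.
by rewrite rmorphM; ring.
Qed.

Lemma zrot_dyadic m (alpha : 'I_m -> int) (l : 'I_m -> nat)
    (S : 'I_m -> {set 'I_n}) :
  exists (k : nat) (f : 'I_(2 ^ n) -> C),
    (forall j, f j ^+ (2 ^ k) = 1) /\
    \prod_(j < m) zrot ((alpha j)%:~R * pi / 2 ^+ l j) (S j) = mon 1%g f.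
Proof.
(* A common exponent for all factors; the successor is there because an angle with denominator
   [2 ^ l j] is measured against pi, not 2 pi. *)
rewrite prod_zrot; exists (\max_j l j).+1; eexists; split; last by [].
move=> i /=; rewrite cis_sum -prodrXl; apply: big1 => j _.
apply: (@expr2_le _ _ (l j).+1); first by rewrite ltnS leq_bigmax.
have -> : (alpha j)%:~R * pi / 2 ^+ l j * (chis (S j) i)%:~R =
    (alpha j * chis (S j) i)%:~R * pi / 2 ^+ l j :> R by rewrite rmorphM /=; ring.
exact: cis_dyadic.
Qed.

End DyadicDiagonals.

(** * The dyadic form of generalized semi-Clifford gates in the hierarchy *)

Lemma CHlevel_CH (R : realType) (n k : nat) (U : 'M[R[i]]_(2 ^ n)) :
  CHlevel k U -> CH U.
Proof. by case: k => // k Uk; exists k.+1. Qed.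

Lemma CH_clifford_sandwich (R : realType) (n : nat)
    (C1 U C2 : 'M[R[i]]_(2 ^ n)) :
  clifford C1 -> clifford C2 -> CH U -> CH (C1 *m U *m C2).
Proof.
(* The level is raised by one so that it is at least 2, where Clifford factors are absorbed. *)
move=> C1cl C2cl [[//|k] _ /CHlevelS Uk].
exact: CHlevel_CH (CHlevel_mulr C2cl (CHlevel_mull C1cl Uk)).
Qed.

Unset Implicit Arguments.

Theorem mainTheorem2 (R : realType) (n : nat) (hn : (1 <= n)%N)
    (U : 'M[R[i]]_(2 ^ n)) (hU : gen_semi_clifford U) :
  CH U <->
  exists (C1 P D C2 : 'M[R[i]]_(2 ^ n)),
    [/\ clifford C1 /\ clifford C2,
        is_perm_mx P /\ CH P,
        is_diag_mx D /\ CH D,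
        (exists (m : nat) (alpha : 'I_m -> int) (k : 'I_m -> nat)
                (S : 'I_m -> {set 'I_n}),
           (forall j, (0 < k j)%N) /\
           D = \prod_(j < m) zrot ((alpha j)%:~R * pi / 2 ^+ k j) (S j)) &
        eq_phase U (C1 *m P *m D *m C2)].
Proof.
split=> [UCH|[C1 [P [D [C2 [[C1cl C2cl]]]]]]]; last first.
  move=> [/is_perm_mxP[s PE] [kP _ PCH]] _ [m [alpha [l [S [_ DE]]]]] [c c1 ->].
  have [k [f [fk fE]]] := zrot_dyadic R alpha l S.
  have [k' _] : CH (C1 *m (P *m D) *m C2).
    apply: CH_clifford_sandwich => //; move: PCH.
    rewrite DE fE PE perm_mx_mon -mon_split; case: kP => // kP PCH.
    apply: CHlevel_CH; apply: (CHlevel_perm_dyadic PCH) => j.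
    (* One spare doubling supplies the successor exponent that [CHlevel_perm_dyadic] asks for. *)
    exact: (expr2_le (leqnSn k)).
  by rewrite !mulmxA => Uk; apply: CHlevel_CH (CHlevel_scale c1 Uk).
have [_ [C1 [P [C2 [m [theta [S [C1cl C2cl P_perm _ [c c1 UE]]]]]]]]] := hU.
have /is_perm_mxP[s PE] := P_perm.
have C1u := clifford_unitary C1cl; have C2u := clifford_unitary C2cl.
pose f i := cis (\sum_j theta j * (chis (S j) i)%:~R).
have f1 i : `|f i| = 1 := cis_norm _.
have f0 i : f i != 0 := phase_neq0 (f1 i).
have UfE : U = c *: (C1 *m mon (s^-1)%g f *m C2).
  by rewrite UE PE prod_zrot perm_mx_mon [in RHS]mon_split !mulmxA.
have [k _ fCH] : CH (mon (s^-1)%g f).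
  (* Undoing the Clifford factors and the phase leaves a monomial gate in the hierarchy. *)
  have -> : mon (s^-1)%g f = C1^t* *m (c^-1 *: U) *m C2^t*.
    rewrite UfE scalerA mulVf ?phase_neq0 // scale1r !mulmxA mulmxtVK //.
    by rewrite (adj_mulmxV C1u) mul1mx.
  apply: CH_clifford_sandwich; try exact: clifford_adj.
  have [k _ Uk] := UCH; apply: CHlevel_CH (CHlevel_scale _ Uk).
  exact: phaseV.
case: k fCH => // k /(CHlevel_mon f1)[PCH [l fl]].
(* Only ratios of entries are known to be dyadic, so the diagonal is normalized at one entry, which
   later joins the global phase. *)
pose g i := f i / f (unbits 0).
have gl i : g i ^+ (2 ^ l) = 1 := fl _ _.
exists C1, P, (mon 1%g g), C2; split=> //.
- by rewrite PE perm_mx_is_perm perm_mx_mon.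
- split; last exact: CHlevel_CH (CHlevel_dyadic_diag gl).
  apply/is_diag_mxP => i j neq_ij; rewrite mxE perm1.
  by rewrite -val_eqE (negPf neq_ij) mul0r.
- exact: dyadic_diag_prod_zrot gl.
exists (c * f (unbits 0)); first by rewrite normrM c1 f1 mulr1.
rewrite UfE -scalerA PE perm_mx_mon -(mulmxA _ _ (mon 1%g g)) -mon_split.
congr (_ *: _); rewrite scalemxAl scalemxAr scale_mon; congr (_ *m _ *m _).
by apply: mon_ext => j; rewrite mulrC divfK.
Qed.
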